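(* Let $(X,d)$ be an $\mathcal{F}$-complete $\mathcal{F}$-metric space, let $\varphi$ be an altering distance function, and let $T:X\to X$ be a continuous map such that $$\varphi(d(Tx,Ty))<\frac12\{\varphi(d(x,Tx))+\varphi(d(y,Ty))\}\quad\text{for all } x,y\in X\text{ with } x\neq y.$$ Assume also that for any $x\in X$ and any $\epsilon>0$ there exists $\delta>0$ such that, for any $i,j\in\mathbb{N}$, $$\varphi(d(T^ix,T^jx))<\epsilon+\delta\ \Rightarrow\ \varphi(d(T^{i+1}x,T^{j+1}x))\le\epsilon.$$ Then $T$ has a unique fixed point, and for any $x\in X$ the sequence of iterates $\{T^nx\}$ converges to that fixed point.
   Context: Let $\mathcal{F}$ be the set of functions $f:[0,\infty)\to\mathbb{R}$ such that: ($\mathcal{F}_1$) $f$ is non-decreasing, i.e. $0<s<t\Rightarrow f(s)\le f(t)$; ($\mathcal{F}_2$) for every sequence $\{t_n\}\subseteq(0,\infty)$, $\lim_{n\to\infty}t_n=0 \iff \lim_{n\to\infty}f(t_n)=-\infty$. Let $X$ be a non-empty set and $d:X\times X\to[0,\infty)$ a map. Then $d$ is an $\mathcal{F}$-metric on $X$, and $(X,d)$ is an $\mathcal{F}$-metric space, if there exists $(f,\alpha)\in\mathcal{F}\times[0,\infty)$ such that: (D1) for all $x,y\in X$, $d(x,y)=0\iff x=y$; (D2) $d(x,y)=d(y,x)$ for all $x,y\in X$; (D3) for every $(x,y)\in X\times X$, every $N\in\mathbb{N}$ with $N\ge 2$, and every $(u_i)_{i=1}^N\subseteq X$ with $(u_1,u_N)=(x,y)$,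 we have $d(x,y)>0\Rightarrow f(d(x,y))\le f\big(\sum_{i=1}^{N-1}d(u_i,u_{i+1})\big)+\alpha$. For $x\in X$ and $r>0$ put $B(x,r)=\{y\in X: d(x,y)<r\}$. A set $U\subseteq X$ is $\mathcal{F}$-open if for every $x\in U$ there is $r>0$ with $B(x,r)\subseteq U$; the $\mathcal{F}$-open sets form the topology $\tau_{\mathcal{F}}$ on $X$. Continuity and convergence are with respect to $\tau_{\mathcal{F}}$; $x_n\to x$ is equivalent to $\lim_{n\to\infty}d(x_n,x)=0$. A sequence $\{x_n\}$ is $\mathcal{F}$-Cauchy if $\lim_{n,m\to\infty}d(x_n,x_m)=0$, and $(X,d)$ is $\mathcal{F}$-complete if every $\mathcal{F}$-Cauchy sequence converges to a point of $X$. An altering distance function is a function $\varphi:[0,\infty)\to[0,\infty)$ that is continuous, non-decreasing, and satisfies $\varphi(t)=0\iff t=0$. *)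

(* Defs.v *)
From HB Require Import structures.
From mathcomp Require Import all_boot all_order all_algebra.
From mathcomp Require Import all_classical all_reals all_analysis.

Set Implicit Arguments.
Unset Strict Implicit.
Unset Printing Implicit Defensive.

Import Order.TTheory GRing.Theory Num.Theory.
Import numFieldNormedType.Exports.

Local Open Scope classical_set_scope.
Local Open Scope ring_scope.

(* Functions with domain or codomain [0, +oo[ are total functions R -> R that
   are only constrained on [0, +oo[. *)

(* The class F; no condition involves the value of f at 0. *)
Definition Fclass (R : realType) (f : R -> R) : Prop :=
  (forall s t : R, 0 < s -> s < t -> f s <= f t) /\
  (forall t : nat -> R, (forall n, 0 < t n) ->
     (t n @[n --> \oo] --> (0 : R)) <-> (f (t n) @[n --> \oo] --> -oo)).

(* The finite sequence (u_1, ..., u_N) is the restriction of u : nat -> X. *)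
Definition is_Fmetric (R : realType) (X : Type) (d : X -> X -> R) : Prop :=
  (forall x y, 0 <= d x y) /\
  exists (f : R -> R) (alpha : R),
    [/\ Fclass f /\ 0 <= alpha,
        forall x y, d x y = 0 <-> x = y,
        forall x y, d x y = d y x
      & forall (x y : X) (N : nat) (u : nat -> X),
          (2 <= N)%N -> u 1%N = x -> u N = y -> 0 < d x y ->
          f (d x y) <= f (\sum_(1 <= i < N) d (u i) (u i.+1)) + alpha].

Definition Fball (R : realType) (X : Type) (d : X -> X -> R) (x : X) (r : R)
  : set X := [set y | d x y < r].

Definition Fopen (R : realType) (X : Type) (d : X -> X -> R) (U : set X)
  : Prop := forall x, U x -> exists2 r : R, 0 < r & Fball d x r `<=` U.

(* The set X with the topology of the F-open sets. These sets form a topology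
   for an arbitrary d, hence no axiom on d is needed here. *)
Definition Fspace (R : realType) (X : Type) (d : X -> X -> R) : Type := X.

Section FspaceTopology.
Variables (R : realType) (X : Type) (d : X -> X -> R).

HB.instance Definition _ := gen_eqMixin (Fspace d).
HB.instance Definition _ := gen_choiceMixin (Fspace d).

Lemma FopenT : @Fopen R X d setT.
Proof. by move=> x _; exists 1. Qed.

Lemma FopenI : setI_closed (@Fopen R X d).
Proof.
move=> A B oA oB x [/oA[r r0 rA] /oB[s s0 sB]].
exists (Num.min r s); first by rewrite lt_min r0.
by move=> y; rewrite /Fball /= lt_min => /andP[yr ys]; split; [exact: rA|exact: sB].
Qed.

Lemma Fopen_bigU (I : Type) (A : I -> set X) :
  (forall i, Fopen d (A i)) -> Fopen d (\bigcup_i A i).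
Proof.
move=> oA x [i _ /oA[r r0 rA]]; exists r => // y yr.
by exists i => //; exact: rA.
Qed.

HB.instance Definition _ :=
  @isOpenTopological.Build (Fspace d) (Fopen d) FopenT FopenI Fopen_bigU.

Lemma open_FspaceE : (@open (Fspace d)) = Fopen d.
Proof. by []. Qed.

End FspaceTopology.

Definition Fcauchy (R : realType) (X : Type) (d : X -> X -> R) (u : nat -> X)
  : Prop := d (u p.1) (u p.2) @[p --> (\oo, \oo)] --> (0 : R).

Definition Fcomplete (R : realType) (X : Type) (d : X -> X -> R) : Prop :=
  forall u : nat -> X, Fcauchy d u ->
    exists z : X, u n @[n --> \oo] --> (z : Fspace d).

Definition altering_distance (R : realType) (phi : R -> R) : Prop :=
  [/\ forall t, 0 <= t -> 0 <= phi t,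
      {within `[0, +oo[, continuous phi},
      forall s t, 0 <= s -> s <= t -> phi s <= phi t
    & forall t, 0 <= t -> (phi t = 0 <-> t = 0)].

(* Main.v *)
(* By contractivity the numbers s_n = phi (d (T^n x) (T^(n+1) x)) decrease, and
   the condition on the iterates with epsilon = inf s_n excludes a positive
   infimum, so s_n tends to 0. Contractivity then bounds
   phi (d (T^(i+1) x) (T^(j+1) x)) by (s_i + s_j) / 2, so the iterates are
   Cauchy. Their limit is fixed by continuity of T, because the F-topology is
   Hausdorff: (D3) bounds d along chains, and the points reached from x by
   chains of length < s form an F-open set, inside a given ball if s is small. *)
Require Import Defs.
From mathcomp Require Import all_boot all_order all_algebra.
From mathcomp Require Import all_classical all_reals all_analysis.
From mathcomp Require Import lra.

Set Implicit Arguments.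
Unset Strict Implicit.

Import Order.TTheory GRing.Theory Num.Theory.
Import numFieldNormedType.Exports.
Local Open Scope classical_set_scope.
Local Open Scope ring_scope.

Section FmetricTopology.
Context {R : realType} {X : Type} {d : X -> X -> R}.
Hypothesis d_Fmetric : is_Fmetric d.

Lemma Fmetric_ge0 x y : 0 <= d x y.
Proof. by case: d_Fmetric. Qed.

Lemma Fmetric_eq0 x y : d x y = 0 <-> x = y.
Proof. by case: d_Fmetric => _ [f [a [_ h _ _]]]. Qed.

Lemma Fmetric_xx x : d x x = 0.
Proof. exact/Fmetric_eq0. Qed.

Lemma Fmetric_sym x y : d x y = d y x.
Proof. by case: d_Fmetric => _ [f [a [_ _ h _]]]. Qed.

(** Otherwise some points [t n] in []0, 1/(n+1)[] satisfy [c <= f (t n)], although [t] tends to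
    0. *)
Lemma Fclass_lt_near0 (f : R -> R) (c : R) : Fclass f ->
  exists2 s : R, 0 < s & forall t, 0 < t -> t < s -> f t < c.
Proof.
move=> [_ f_lim]; apply: contrapT => no_s.
have /choice[t tP] (n : nat) :
    exists t : R, [/\ 0 < t, t < n.+1%:R^-1 & c <= f t].
  apply: contrapT => no_t; apply: no_s; exists n.+1%:R^-1 => [|t t0 tn].
    by rewrite invr_gt0.
  by rewrite ltNge; apply/negP => ct; apply: no_t; exists t.
have t_cvg : t n @[n --> \oo] --> (0 : R).
  apply: (@squeeze_cvgr _ _ _ _ (fun=> 0) (fun n => n.+1%:R^-1)).
  - by near=> n; have [t0 tn _] := tP n; rewrite !ltW.
  - exact: cvg_cst.
  - exact: cvg_harmonic.
have : f (t n) @[n --> \oo] --> -oo by apply/f_lim => // n; have [] := tP n.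
move=> /cvgrNyPlt/(_ c)[N _ /(_ N (leqnn N))] /=.
by have [_ _ cf] := tP N; rewrite ltNge cf.
Unshelve. all: by end_near. Qed.

(** The value [f 0] is arbitrary, so (D3) gives no information on chains of length 0; here every
    link vanishes. *)
Lemma Fmetric_chain0 (N : nat) (u : nat -> X) : (2 <= N)%N ->
  \sum_(1 <= i < N) d (u i) (u i.+1) = 0 -> u 1%N = u N.
Proof.
elim: N => // -[//|N] IH _; rewrite big_nat_recr//= => /eqP.
rewrite paddr_eq0 ?Fmetric_ge0 ?sumr_ge0// => [|i _]; last exact: Fmetric_ge0.
move=> /andP[/eqP sum0 /eqP/Fmetric_eq0 <-].
by case: N IH sum0 => // N IH sum0; exact: IH.
Qed.

(** A substitute for the triangle inequality, uniform in the number of links. With [f < f r - a] on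
    []0, s[], a distance at least [r] would give [f r <= f (sum) + a < f r]. *)
Lemma Fmetric_chain_lt (r : R) : 0 < r ->
  exists2 s : R, 0 < s & forall (N : nat) (u : nat -> X), (2 <= N)%N ->
    \sum_(1 <= i < N) d (u i) (u i.+1) < s -> d (u 1%N) (u N) < r.
Proof.
case: (d_Fmetric) => _ [f [a [[Ff _] _ _ D3]]] r0.
have [s s0 fs] := Fclass_lt_near0 (f r - a) Ff.
exists s => // N u N2 sum_lt; rewrite ltNge; apply/negP => rd.
have d0 : 0 < d (u 1%N) (u N) by exact: lt_le_trans rd.
have fr : f r <= f (d (u 1%N) (u N)).
  by move: rd; rewrite le_eqVlt => /predU1P[<-//|]; exact: (proj1 Ff).
have sum_gt0 : 0 < \sum_(1 <= i < N) d (u i) (u i.+1).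
  rewrite lt_neqAle sumr_ge0 ?andbT => [|i _]; last exact: Fmetric_ge0.
  apply/eqP => /esym/(Fmetric_chain0 N2)/Fmetric_eq0 e.
  by rewrite e ltxx in d0.
have := D3 _ _ N u N2 erefl erefl d0; have := fs _ sum_gt0 sum_lt; lra.
Qed.

Lemma Fmetric_trans_lt (r : R) : 0 < r ->
  exists2 s : R, 0 < s & forall x y z, d x y < s -> d y z < s -> d x z < r.
Proof.
move=> /Fmetric_chain_lt[s s0 chain_lt].
exists (s / 2) => [|x y z xy yz]; first by rewrite divr_gt0.
(* Chains are indexed from 1, so the entry at index 0 is padding. *)
have := chain_lt 3%N (nth x [:: x; x; y; z]) erefl.
by rewrite big_ltn// big_nat1 /=; apply; lra.
Qed.

Lemma nbhs_Fball (x : Fspace d) (r : R) : 0 < r -> nbhs x (Fball d x r).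
Proof.
move=> /Fmetric_chain_lt[s s0 chain_lt].
(* The ball itself need not be F-open, hence this smaller neighbourhood. *)
pose V : set (Fspace d) := [set y | exists N (u : nat -> X),
  [/\ (2 <= N)%N, u 1%N = x, u N = y & \sum_(1 <= i < N) d (u i) (u i.+1) < s]].
rewrite nbhsE/=; exists V; last first.
  by move=> y [N [u [N2 <- <- sum_lt]]]; exact: chain_lt.
split; last first.
  by exists 2%N, (fun=> x); rewrite big_nat1 Fmetric_xx.
rewrite open_FspaceE => y [N [u [N2 ux uy sum_lt]]].
(* The radius is the slack of the chain to [y]: adding a last link from [y] to [z] keeps the length
   below [s]. *)
exists (s - \sum_(1 <= i < N) d (u i) (u i.+1)); first by rewrite subr_gt0.
move=> z; rewrite /Fball/= => yz.
exists N.+1, (fun i => if (i <= N)%N then u i else z).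
have N1 : (1 <= N)%N by exact: ltnW.
rewrite N1 ltnn ltnS N1; split => //.
rewrite big_nat_recr//= leqnn ltnn uy.
rewrite (eq_big_nat _ _ (F2 := fun i => d (u i) (u i.+1))); first lra.
by move=> i /andP[_ iN]; rewrite (ltnW iN) iN.
Qed.

Lemma Fspace_hausdorff : hausdorff_space (Fspace d).
Proof.
move=> x y xy; apply: contrapT => nxy.
have d0 : 0 < d x y.
  by rewrite lt_neqAle Fmetric_ge0 andbT; apply/eqP => /esym/Fmetric_eq0.
have [s s0 trans_lt] := Fmetric_trans_lt d0.
have [z [xz yz]] := xy _ _ (nbhs_Fball x s0) (nbhs_Fball y s0).
by have := trans_lt x z y xz; rewrite Fmetric_sym ltxx => /(_ _)/notF; apply.
Qed.

End FmetricTopology.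

(** Monotonicity allows [e := phi r], which is positive because [phi] vanishes only at 0. *)
Lemma altering_lt (R : realType) (phi : R -> R) (r : R) :
  altering_distance phi -> 0 < r ->
  exists2 e : R, 0 < e & forall t, 0 <= t -> phi t < e -> t < r.
Proof.
move=> [phi_ge0 _ phi_mono phi_eq0] r0; exists (phi r).
  rewrite lt_neqAle phi_ge0 ?ltW// andbT; apply/eqP => /esym/phi_eq0.
  by move=> /(_ (ltW r0)) e; rewrite e ltxx in r0.
move=> t t0; rewrite !ltNge; apply: contraNN => rt.
by apply: phi_mono => //; exact: ltW.
Qed.

Section Iterates.
Context {R : realType} {X : Type} {d : X -> X -> R} {phi : R -> R} {T : X -> X}.
Hypothesis d_Fmetric : is_Fmetric d.
Hypothesis phi_altering : altering_distance phi.
Hypothesis T_contractive : forall x y : X, x <> y ->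
  phi (d (T x) (T y)) < 1 / 2 * (phi (d x (T x)) + phi (d y (T y))).

Lemma altering_Fmetric_ge0 x y : 0 <= phi (d x y).
Proof. by case: phi_altering => h _ _ _; exact/h/Fmetric_ge0. Qed.

Lemma altering_Fmetric_xx x : phi (d x x) = 0.
Proof. by case: phi_altering => _ _ _ h; apply/h; rewrite Fmetric_xx. Qed.

Lemma contractive_le x y :
  phi (d (T x) (T y)) <= 1 / 2 * (phi (d x (T x)) + phi (d y (T y))).
Proof.
have [->|/T_contractive/ltW//] := pselect (x = y).
have := altering_Fmetric_ge0 y (T y); rewrite altering_Fmetric_xx; lra.
Qed.

Lemma contractive_fixed_unique x y : T x = x -> T y = y -> x = y.
Proof.
move=> Tx Ty; apply: contrapT => /T_contractive.
have := altering_Fmetric_ge0 x y.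
rewrite Tx Ty !altering_Fmetric_xx; lra.
Qed.

(** For the pair [x], [T x], the left side of the contractive inequality reappears on the right with
    factor 1/2 and is absorbed. *)
Lemma displacement_le x : phi (d (T x) (T (T x))) <= phi (d x (T x)).
Proof. by have := contractive_le x (T x); lra. Qed.

Lemma displacement_lt x :
  0 < phi (d x (T x)) -> phi (d (T x) (T (T x))) < phi (d x (T x)).
Proof.
move=> x_gt0; have nx : x <> T x.
  by move=> e; move: x_gt0; rewrite -e altering_Fmetric_xx ltxx.
by have := T_contractive nx; lra.
Qed.

Lemma displacement_iter_le x m n : (m <= n)%N ->
  phi (d (iter n T x) (iter n.+1 T x)) <= phi (d (iter m T x) (iter m.+1 T x)).
Proof.
move=> /subnK <-; elim: (n - m)%N => [//|k].
by apply: le_trans; exact: displacement_le.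
Qed.

Variable x : X.
Hypothesis T_iterates : forall epsilon : R, 0 < epsilon ->
  exists2 delta : R, 0 < delta &
    forall i j : nat, (1 <= i)%N -> (1 <= j)%N ->
      phi (d (iter i T x) (iter j T x)) < epsilon + delta ->
      phi (d (iter i.+1 T x) (iter j.+1 T x)) <= epsilon.

Lemma displacement_small (e : R) : 0 < e ->
  exists N, forall n, (N <= n)%N -> phi (d (iter n T x) (iter n.+1 T x)) < e.
Proof.
move=> e0; pose s n := phi (d (iter n T x) (iter n.+1 T x)).
have s_ge0 n : 0 <= s n by exact: altering_Fmetric_ge0.
have s_inf : has_inf (range s).
  by split; [exists (s 0%N), 0%N | exists 0 => _ [n _ <-]].
have inf_le n : inf (range s) <= s n.
  by apply: ge_inf; [case: s_inf | exists n].
have inf_le0 : inf (range s) <= 0.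
  rewrite leNgt; apply/negP => l0.
  have [delta delta0 step] := T_iterates l0.
  have [_ [n _ <-] sn] := inf_adherent delta0 s_inf.
  (* Since [n] may be 0 and [step] needs positive indices, it is applied at [n.+1] and [n.+2]. *)
  have le1 : s n.+2 <= inf (range s).
    apply: step => //; apply: le_lt_trans sn.
    exact: displacement_iter_le.
  (* One more strict decrease falls below the infimum. *)
  have : s n.+3 < s n.+2.
    by apply: displacement_lt; exact: lt_le_trans (inf_le n.+2).
  by rewrite ltNge (le_trans le1).
have [_ [N _ <-] sN] := inf_adherent e0 s_inf.
exists N => n Nn; apply: le_lt_trans (displacement_iter_le x Nn) _.
by apply: lt_le_trans sN _; rewrite -lerBrDr subrr.
Qed.

Lemma iter_Fcauchy : Fcauchy d (fun n => iter n T x).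
Proof.
apply/cvgr0Pnorm_lt => r r0.
have [e e0 phi_lt] := altering_lt phi_altering r0.
have [N small] := displacement_small e0.
(* Indices above [N] are successors [i.+1], [j.+1] with [N <= i] and [N <= j], so the bound by the
   mean of two displacements below [e] applies. *)
exists ([set n | (N < n)%N], [set n | (N < n)%N]) => /=.
  by split; exact: nbhs_infty_gt.
move=> [[|i] [|j]] //= [Ni Nj]; rewrite ger0_norm ?Fmetric_ge0//.
apply: phi_lt; first exact: Fmetric_ge0.
apply: le_lt_trans (contractive_le _ _) _.
by have := small _ Ni; have := small _ Nj; rewrite /=; lra.
Qed.

Lemma iter_cvg_fixed : Fcomplete d -> continuous (T : Fspace d -> Fspace d) ->
  exists2 z, T z = z & iter n T x @[n --> \oo] --> (z : Fspace d).
Proof.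
move=> d_complete T_cont; have [z xz] := d_complete _ iter_Fcauchy.
exists z => //.
(* The shifted sequence tends to [z] as a tail and to [T z] by continuity. *)
have xSz : iter n.+1 T x @[n --> \oo] --> (z : Fspace d).
  exact: (cvg_comp (addn 1) (fun n => iter n T x) (cvg_addnl 1) xz).
have xSTz : iter n.+1 T x @[n --> \oo] --> (T z : Fspace d).
  exact: (cvg_comp _ (T : Fspace d -> Fspace d) xz (T_cont z)).
exact: (cvg_unique (Fspace_hausdorff d_Fmetric) xSTz xSz).
Qed.

End Iterates.

Theorem theorem3p10 (R : realType) (X : Type) (d : X -> X -> R)
    (phi : R -> R) (T : X -> X)
    (X_nonempty : inhabited X)
    (d_Fmetric : is_Fmetric d)
    (d_complete : Fcomplete d)
    (phi_altering : altering_distance phi)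
    (T_continuous : continuous (T : Fspace d -> Fspace d))
    (T_contractive : forall x y : X, x <> y ->
       phi (d (T x) (T y)) < 1 / 2 * (phi (d x (T x)) + phi (d y (T y))))
    (T_iterates : forall (x : X) (epsilon : R), 0 < epsilon ->
       exists2 delta : R, 0 < delta &
         forall i j : nat, (1 <= i)%N -> (1 <= j)%N ->
           phi (d (iter i T x) (iter j T x)) < epsilon + delta ->
           phi (d (iter i.+1 T x) (iter j.+1 T x)) <= epsilon) :
  exists z : X,
    [/\ T z = z,
        forall y : X, T y = y -> y = z
      & forall x : X, iter n T x @[n --> \oo] --> (z : Fspace d)].
Proof.
have iter_cvg x := iter_cvg_fixed d_Fmetric phi_altering T_contractive
  (T_iterates x) d_complete T_continuous.
case: X_nonempty => /iter_cvg[z Tz _].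
have z_unique y : T y = y -> y = z.
  move=> Ty.
  exact: (contractive_fixed_unique d_Fmetric phi_altering T_contractive).
exists z; split => // x.
(* The limit [y] depends on [x] a priori, but it is a fixed point and so equals [z]. *)
by have [y /z_unique ->] := iter_cvg x.
Qed.
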